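(* Let $k$ be a field. Fix an integer $m \geq 1$, and let $\mathcal{H}_m = (\mathcal{X}_{m},\mathcal{E}_{m})$ be the hypergraph with $\mathcal{X}_m = \{z,x_1,\ldots,x_{m+2}\}$ and $\mathcal{E}_m = \{\{z,x_i,x_j\} ~|~ 1 \leq i < j \leq m+2\}$. Then \[\chi(\mathcal{H}_m)-1+m \leq {\rm astab}(J(\mathcal{H}_m)),\] where $J(\mathcal{H}_m)\subseteq k[z,x_1,\ldots,x_{m+2}]$ is the cover ideal of $\mathcal{H}_m$.
   Context: A hypergraph is a pair $\mathcal{H} = (\mathcal{X},\mathcal{E})$ where $\mathcal{X}$ is a finite set of vertices and $\mathcal{E}$ is a collection of subsets of $\mathcal{X}$ (the edges). A subset $W \subseteq \mathcal{X}$ is a vertex cover of $\mathcal{H}$ if $W \cap E \neq \emptyset$ for all $E \in \mathcal{E}$. Identifying vertices with variables of the polynomial ring over $k$ in the variables $\mathcal{X}$, and writing $x_W$ for the product of the variables in $W$, the cover ideal of $\mathcal{H}$ is $J(\mathcal{H}) = \langle x_W ~|~ W \subseteq \mathcal{X} \mbox{ is a vertex cover}\rangle$. A colouring of $\mathcal{H}$ is an assignment of a colour to each vertex of $\mathcal{X}$ so that no edge is mono-coloured, i.e., each edge contains at least two vertices of different colours. The chromatic number $\chi(\mathcal{H})$ is the least number of colours required to colour $\mathcal{H}$. For an ideal $I$ of a polynomial ring $R$, a prime ideal $P$ is an associated prime of $I$ if $P = I:\langle T\rangle$ for some $T\in R$, and ${\rm Ass}(I)$ is the set of all associated primes of $I$.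 By a theorem of Brodmann there is an integer $s_0 \geq 1$ with ${\rm Ass}(I^s)={\rm Ass}(I^{s_0})$ for all $s\geq s_0$; the least such integer $s_0\geq 1$ is the index of stability ${\rm astab}(I)$. *)

(* Defs.v *)
From HB Require Import structures.
From mathcomp Require Import all_boot all_order all_algebra.
From mathcomp Require Import boolp classical_sets.
From mathcomp Require Import mpoly.

Set Implicit Arguments.
Unset Strict Implicit.
Unset Printing Implicit Defensive.

Import GRing.Theory.
Local Open Scope ring_scope.

(* A hypergraph on the finite vertex set [X] is given by its set of edges. *)
Definition hypergraph (X : finType) := {set {set X}}.

Definition vertex_cover (X : finType) (H : hypergraph X) (W : {set X}) : bool :=
  [forall E in H, W :&: E != finset.set0].

Definition colouring (X : finType) (H : hypergraph X) (q : nat)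
    (c : {ffun X -> 'I_q}) : bool :=
  [forall E in H, [exists x in E, [exists y in E, c x != c y]]].

Definition colourable (X : finType) (H : hypergraph X) (q : nat) : bool :=
  [exists c : {ffun X -> 'I_q}, colouring H c].

(* [find] returns the least [q <= #|X|] such that [H] is [q]-colourable, and
   the junk value [#|X|.+1] if there is none (that is, if some edge has at most
   one vertex); see [chromatic_numberP]. *)
Definition chromatic_number (X : finType) (H : hypergraph X) : nat :=
  find (colourable H) (iota 0 #|X|.+1).

Lemma colourable_card (X : finType) (H : hypergraph X) (q : nat) :
  colourable H q -> colourable H #|X|.
Proof.
case/existsP => c /'forall_implyP cP; apply/existsP.
exists [ffun x => enum_rank x]; apply/'forall_implyP => E HE.
case/existsP: (cP E HE) => x /andP[xE /existsP[y /andP[yE cxy]]].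
apply/existsP; exists x; rewrite xE /=; apply/existsP; exists y; rewrite yE /=.
rewrite !ffunE; apply: contraNneq cxy => /enum_rank_inj ->; exact: eqxx.
Qed.

Lemma chromatic_numberP (X : finType) (H : hypergraph X) (q : nat) :
  colourable H q ->
  colourable H (chromatic_number H) /\ (chromatic_number H <= q)%N.
Proof.
move=> Hq; have hasH : has (colourable H) (iota 0 #|X|.+1).
  by apply/hasP; exists #|X|; rewrite ?mem_iota ?(colourable_card Hq) /=.
have ltc : (chromatic_number H < #|X|.+1)%N.
  by move: hasH; rewrite has_find size_iota.
split; first by have := nth_find 0%N hasH; rewrite nth_iota.
rewrite leqNgt; apply/negP => ltq.
have := before_find 0%N ltq.
by rewrite nth_iota ?Hq // (ltn_trans ltq ltc).
Qed.

Local Open Scope classical_set_scope.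

Section Ideals.
Variable R : comNzRingType.
Implicit Types I J P G : set R.

Definition is_ideal I : Prop :=
  [/\ I 0, forall f g, I f -> I g -> I (f + g) & forall r f, I f -> I (r * f)].

(* Not the library's [prime_idealr_closed], which is about boolean predicates;
   membership in the ideals below is not decidable a priori. *)
Definition is_prime_ideal P : Prop :=
  [/\ is_ideal P, ~ P 1 & forall f g, P (f * g) -> P f \/ P g].

Definition ideal_gen G : set R :=
  [set f | exists (n : nat) (r g : 'I_n -> R),
             (forall i, G (g i)) /\ f = \sum_(i < n) r i * g i].

Definition ideal_pow I (s : nat) : set R :=
  ideal_gen [set f | exists g : 'I_s -> R,
                       (forall i, I (g i)) /\ f = \prod_(i < s) g i].

Definition ideal_colon I J : set R := [set f | forall g, J g -> I (f * g)].

Definition Ass I : set (set R) :=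
  [set P | is_prime_ideal P /\
           exists T : R, P = ideal_colon I (ideal_gen [set T])].

Definition Ass_stable_from I (s0 : nat) : Prop :=
  (1 <= s0)%N /\
  forall s : nat, (s0 <= s)%N -> Ass (ideal_pow I s) = Ass (ideal_pow I s0).

(* [is_astab I s0] reads "astab(I) = s0". It is a relation because the
   existence of the index of stability is Brodmann's theorem, for Noetherian
   [R]; uniqueness is immediate from minimality. *)
Definition is_astab I (s0 : nat) : Prop :=
  Ass_stable_from I s0 /\ forall t : nat, Ass_stable_from I t -> (s0 <= t)%N.

End Ideals.

(* The vertex [i : 'I_n] is identified with the variable ['X_i]. *)
Definition cover_ideal (k : fieldType) (n : nat) (H : hypergraph 'I_n) :
    set {mpoly k[n]} :=
  ideal_gen [set f | exists W : {set 'I_n},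
                       vertex_cover H W /\ f = \prod_(i in W) 'X_i].

Arguments cover_ideal k {n} H.

(* The vertices are z = [ord0] and x_i = [lift ord0 i] for [i : 'I_m.+2], so
   that the indices of the x_i start at 0 instead of 1. *)
Definition H_ (m : nat) : hypergraph 'I_m.+3 :=
  [set [set ord0; lift ord0 p.1; lift ord0 p.2]
    | p in [pred p : 'I_m.+2 * 'I_m.+2 | (p.1 < p.2)%N]]%SET.

(* Main.v *)
Require Import Defs.
From mathcomp Require Import all_boot all_order all_algebra.
From mathcomp Require Import boolp classical_sets mpoly.
From mathcomp Require Import zify.

(** Write J for the cover ideal of H_m and n = m + 2 for the number of vertices
    x_i.  Colouring z and x_1 alike and every other vertex differently shows
    that the chromatic number is at most 2, so it is enough to prove that Ass
    is not yet stable at any exponent s0 <= m.  The prime that witnesses this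
    is the irrelevant ideal M = (z, x_1, ..., x_n): it is associated to
    J^(m+1), but to no J^s with s <= m.

    A power of the cover ideal of any hypergraph is a monomial ideal: x^u lies
    in J^s exactly when s vertex covers can be packed below the exponent vector
    u, and a polynomial lies in J^s exactly when all its monomials do
    ([cover_ideal_powP]).  Hence M is associated to J^s exactly when there is a
    socle monomial, that is a u outside of J^s all of whose products with a
    variable are in J^s ([irrelevant_ideal_AssP]); this turns both claims into
    combinatorics of covers.

    A vertex cover of H_m either contains z or misses at most one x_i.  As the
    covers through z can all be shrunk to {z}, packing s covers below u means
    packing t = s - u_z covers that avoid z ([H_cover_packP]), each of which
    uses at least n - 1 = m + 1 of the x_i ([tight_cover_count]).
    - (x_1 ... x_n)^m is a socle monomial of J^(m+1) ([H_socle_not_pack],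
      [H_socle_pack]): its total degree m (m + 2) is one less than the
      (m + 1)^2 required.  Multiplying by x_j provides the missing unit, used
      by the covers that omit one x_i with i <> j; multiplying by z leaves only
      m covers to be found, all equal to {x_1, ..., x_n}.
    - If u is a socle monomial of J^s ([H_socle_bound]), then each x-exponent
      is at most t - 1, for t covers never use x_j more than t times, so that
      a packing below u x_j would fit below u already.  On the other hand
      u x_1 is in J^s, so the x-degree of u is at least t (m + 1) - 1.
      Comparing with (m + 2)(t - 1) gives m + 1 <= t <= s. *)

Set Implicit Arguments.
Unset Strict Implicit.
Unset Printing Implicit Defensive.

(** * Generated ideals and colons by a principal ideal *)

Section Ideals.
Import GRing.Theory.
Local Open Scope ring_scope.
Variable R : comNzRingType.
Implicit Types I G : set R.

Lemma ideal_gen_sub G g : G g -> ideal_gen G g.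
Proof.
move=> Gg; exists 1%N, (fun=> 1), (fun=> g); split=> //.
by rewrite big_ord1 mul1r.
Qed.

Lemma ideal_gen_ideal G : is_ideal (ideal_gen G).
Proof.
split.
- by exists 0%N, (fun=> 0), (fun=> 0); split=> [[]|] //; rewrite big_ord0.
- move=> _ _ [n1 [r1 [g1 [Gg1 ->]]]] [n2 [r2 [g2 [Gg2 ->]]]].
  exists (n1 + n2)%N.
  exists (fun i => match split i with inl j => r1 j | inr j => r2 j end).
  exists (fun i => match split i with inl j => g1 j | inr j => g2 j end).
  split; first by move=> i; case: (split i).
  rewrite big_split_ord /=; congr (_ + _); apply: eq_bigr => i _.
    by case: (splitP (lshift n2 i)) => j /= => [/val_inj -> //|]; have := ltn_ord i; lia.
  by case: (splitP (rshift n1 i)) => j /= => [|/addnI /val_inj -> //]; have := ltn_ord j; lia.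
- move=> r _ [n [r1 [g [Gg ->]]]]; exists n, (fun i => r * r1 i), g; split=> //.
  by rewrite mulr_sumr; apply: eq_bigr => i _; rewrite mulrA.
Qed.

Lemma ideal_sum I (T : eqType) (s : seq T) (F : T -> R) : is_ideal I ->
  (forall x, x \in s -> I (F x)) -> I (\sum_(x <- s) F x).
Proof.
move=> [I0 ID _]; elim: s => [|x s IHs] IF; first by rewrite big_nil.
rewrite big_cons; apply: ID; first by apply: IF; rewrite mem_head.
by apply: IHs => y ys; apply: IF; rewrite inE ys orbT.
Qed.

Lemma ideal_gen_min G I : is_ideal I -> (forall g, G g -> I g) ->
  forall f, ideal_gen G f -> I f.
Proof.
move=> idI GI _ [n [r [g [Gg ->]]]]; apply: ideal_sum => // i _.
by case: idI => _ _; apply; apply: GI.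
Qed.

Lemma ideal_colon_principal I T f : is_ideal I ->
  ideal_colon I (ideal_gen [set T]) f <-> I (f * T).
Proof.
move=> [I0 ID IM]; split=> [|If]; first by apply; apply: ideal_gen_sub.
apply: (ideal_gen_min (I := [set g | I (f * g)])) => /=; last by move=> _ ->.
split=> /= [|g h Ig Ih|r g Ig]; first by rewrite mulr0.
  by rewrite mulrDr; apply: ID.
by rewrite mulrCA; apply: IM.
Qed.

End Ideals.

(** * Powers of cover ideals and their socle monomials *)

(** The exponent vectors of the monomials of the s-th power of the cover
    ideal.  The covers are kept in a sequence, with repetitions, so that
    multiplying monomials is concatenation and the exponent contributed at x
    is a [count]. *)
Definition cover_pack (X : finType) (H : hypergraph X) (s : nat)
    (u : X -> nat) : Prop :=
  exists ws : seq {set X}, [/\ size ws = s, all (vertex_cover H) ws &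
    forall x, count (fun W : {set X} => x \in W) ws <= u x].

Lemma cover_pack_le (X : finType) (H : hypergraph X) s (u v : X -> nat) :
  (forall x, u x <= v x) -> cover_pack H s u -> cover_pack H s v.
Proof.
move=> uv [ws [sz cv cnt]]; exists ws; split=> // x.
exact: leq_trans (cnt x) (uv x).
Qed.

Section CoverIdeal.
Import GRing.Theory.
Local Open Scope ring_scope.
Variables (k : fieldType) (n : nat) (H : hypergraph 'I_n).
Implicit Types (f g : {mpoly k[n]}) (u v : 'X_{1..n}).

(** The span of the monomials with exponents in [cover_pack H s].  It is shown
    to be the s-th power of the cover ideal. *)
Let supported (s : nat) : set {mpoly k[n]} :=
  [set f | forall u, u \in msupp f -> cover_pack H s u].

Let supportedM s t f g :
  supported s f -> supported t g -> supported (s + t) (f * g).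
Proof.
move=> sf tg w /msuppM_le /allpairsP[[u v] /= [uf vg ->]].
have [ws [wsz wcv wct]] := sf u uf; have [xs [xsz xcv xct]] := tg v vg.
exists (ws ++ xs); rewrite size_cat wsz xsz all_cat wcv xcv; split=> // x.
by rewrite count_cat mnmDE leq_add.
Qed.

Let supported_ideal s : is_ideal (supported s).
Proof.
split=> [u|f g sf sg u /msuppD_le|r f sf]; first by rewrite -mpolyC0 msupp0.
  by rewrite mem_cat => /orP[/sf|/sg].
rewrite -[s]add0n; apply: supportedM => // u _.
by exists [::].
Qed.

Lemma prod_mpolyX_set (W : {set 'I_n}) :
  \prod_(i in W) 'X_i = 'X_[[multinom (i \in W : nat) | i < n]] :> {mpoly k[n]}.
Proof.
rewrite mpolyXE_id big_mkcond; apply: eq_bigr => i _ /=.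
by rewrite mnmE; case: (i \in W).
Qed.

(** The left-to-right direction holds because each generator of the power has
    all its monomials of the required form; conversely each such monomial is a
    multiple of the product of the generators given by the packed covers. *)
Lemma cover_ideal_powP s f : ideal_pow (cover_ideal k H) s f <->
  forall u, u \in msupp f -> cover_pack H s u.
Proof.
have genJ g : cover_ideal k H g -> supported 1 g.
  apply: ideal_gen_min => [|_ [W [cW ->]] u]; first exact: supported_ideal.
  rewrite prod_mpolyX_set msuppX inE => /eqP ->; exists [:: W].
  by rewrite /= cW; split=> // x; rewrite mnmE addn0.
split=> [|sf].
  apply: (ideal_gen_min (I := supported s)) => [|_ [g [Jg ->]]].
    exact: supported_ideal.
  elim: s g Jg => [|s IHs] g Jg.
    by move=> u _; exists [::].
  rewrite big_ord_recl; apply: (@supportedM 1 s); first exact: genJ.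
  by apply: IHs.
have idJ : is_ideal (ideal_pow (cover_ideal k H) s) by apply: ideal_gen_ideal.
rewrite [f]mpolyE; apply: ideal_sum => // u /sf [ws [wsz wcv wct]].
pose w : 'X_{1..n} :=
  [multinom count (fun W : {set 'I_n} => i \in W) ws | i < n].
have le_wu : (w <= u)%MM by apply/mnm_lepP => i; rewrite mnmE.
have Xw : 'X_[w] = \prod_(W <- ws) \prod_(i in W) 'X_i :> {mpoly k[n]}.
  rewrite /w; elim: ws {w wsz wcv wct le_wu} => [|W ws IHws].
    by rewrite big_nil -mpolyX0; congr 'X_[_]; apply/mnmP => i; rewrite !mnmE.
  rewrite big_cons -IHws prod_mpolyX_set -mpolyXD; congr 'X_[_].
  by apply/mnmP => i; rewrite !mnmE.
rewrite -(submK le_wu) mpolyXD -mul_mpolyC mulrA.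
case: (idJ) => _ _; apply; apply: ideal_gen_sub.
exists (fun j => \prod_(i in nth finset.set0 ws j) 'X_i); split=> [j|].
  apply: ideal_gen_sub; exists (nth finset.set0 ws j); split=> //.
  by apply: (allP wcv); rewrite mem_nth // wsz.
by rewrite Xw (big_nth finset.set0) wsz big_mkord.
Qed.

Definition irrelevant_ideal : set {mpoly k[n]} := [set f | f@_0%MM = 0].

Lemma irrelevant_ideal_prime : is_prime_ideal irrelevant_ideal.
Proof.
split; first split; rewrite /irrelevant_ideal /=.
- by rewrite mcoeff0.
- by move=> f g f0 g0; rewrite mcoeffD f0 g0 addr0.
- by move=> r f f0; rewrite rmorphM /= f0 mulr0.
- by rewrite rmorph1; apply/eqP; rewrite oner_eq0.
move=> f g; rewrite rmorphM /= => /eqP; rewrite mulf_eq0.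
by case/orP=> /eqP; [left | right].
Qed.

(** If M = I : T with I monomial, then T is not in I, so some monomial u of T
    is not in I, while each x_i u is a monomial of x_i T, which is in I.
    Conversely T = x^u works: f x^u is in I when f has no constant term, and
    otherwise u itself is a monomial of f x^u. *)
Lemma irrelevant_ideal_AssP s :
  Ass (ideal_pow (cover_ideal k H) s) irrelevant_ideal <->
  exists u, ~ cover_pack H s u /\ forall i, cover_pack H s (u + U_(i))%MM.
Proof.
have idJ : is_ideal (ideal_pow (cover_ideal k H) s) by apply: ideal_gen_ideal.
split=> [[_ [T eqT]]|[u [Nu uU]]].
  have colT f : irrelevant_ideal f <-> ideal_pow (cover_ideal k H) s (f * T).
    by rewrite eqT; apply: ideal_colon_principal.
  (* 1 is not in M = I : T, hence T is not in I *)
  have /existsNP [u Nu] : ~ forall u, u \in msupp T -> cover_pack H s u.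
    move=> /cover_ideal_powP; rewrite -[T]mul1r => /colT.
    by case: irrelevant_ideal_prime.
  have /not_implyP [uT Nsu] := Nu; exists u; split=> // i.
  have /colT/cover_ideal_powP : irrelevant_ideal 'X_i.
    rewrite /irrelevant_ideal /= mcoeffX; case: eqP => // /mnmP/(_ i).
    by rewrite mnm1E mnm0E eqxx.
  apply; rewrite mcoeff_msupp mulrC addmC mcoeffMX -mcoeff_msupp //.
split; first exact: irrelevant_ideal_prime.
exists 'X_[u]; apply/seteqP; split=> f; last first.
  move=> /(ideal_colon_principal _ _ idJ)/cover_ideal_powP f_u.
  apply/eqP/negPn/negP => f0; apply/Nu/f_u.
  by rewrite mcoeff_msupp -[X in _@_X]addm0 mcoeffMX.
rewrite /irrelevant_ideal /= => f0.
apply/(ideal_colon_principal _ _ idJ)/cover_ideal_powP => w.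
rewrite (perm_mem (msuppMX f u)) => /mapP[v vf ->].
have /existsP [i vi] : [exists i, v i != 0%N].
  rewrite -negb_forall; apply: contraL vf => /forallP v0.
  rewrite -mcoeff_eq0 -[X in _ == X]f0; apply/eqP; congr (f@_ _).
  by apply/mnmP => i; rewrite mnm0E; apply/eqP.
apply: cover_pack_le (uU i) => x; rewrite !mnmDE leq_add2l mnm1E.
by case: eqP => // <-; rewrite lt0n.
Qed.

End CoverIdeal.

(** * Vertex covers and colourings of H_m *)

(** If z and two of the x_i were missed, so would the edge they form. *)
Lemma vertex_cover_HE m W : vertex_cover (H_ m) W =
  (ord0 \in W) || (#|[set i : 'I_m.+2 | lift ord0 i \notin W]%SET| <= 1).
Proof.
apply/forall_inP/orP => [cW|cW E /imsetP[[i j] /= ij ->]].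
  case: (boolP (ord0 \in W)) => [|z_W]; [by left | right].
  apply/card_le1_eqP.
  suff lt_abs (i j : 'I_m.+2) : lift ord0 i \notin W -> lift ord0 j \notin W ->
      ~~ (i < j).
    move=> i j; rewrite !inE => iW jW; apply/val_inj/eqP.
    by rewrite eqn_leq leqNgt lt_abs //= leqNgt lt_abs.
  move=> iW jW; apply/negP => ij; have /set0Pn[] : W :&: 
     [set ord0; lift ord0 i; lift ord0 j]%SET != finset.set0.
    by apply: cW; apply/imsetP; exists (i, j).
  move=> x; rewrite !inE => /andP[xW /orP[/orP[]|] /eqP xE].
  - by rewrite -xE xW in z_W.
  - by rewrite -xE xW in iW.
  - by rewrite -xE xW in jW.
apply/set0Pn; case: cW => [zW|/card_le1_eqP cW].
  by exists ord0; rewrite !inE zW.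
case: (boolP (lift ord0 i \in W)) => iW.
  by exists (lift ord0 i); rewrite !inE iW eqxx orbT.
exists (lift ord0 j); rewrite !inE eqxx orbT andbT.
apply: contraLR ij => jW; rewrite unfold_in /= (cW i j) ?ltnn // inE //.
Qed.

(** The vertices 0 and 1, that is z and the first x_i, share a colour; an edge
    {z, x_i, x_j} with i < j is then split by z and x_j. *)
Lemma H_colourable2 m : colourable (H_ m) 2.
Proof.
apply/existsP; exists [ffun x : 'I_m.+3 => if x <= 1 then ord0 else ord_max].
apply/forall_inP => E /imsetP[[i j] /= ij ->].
apply/existsP; exists ord0; rewrite !inE eqxx /=.
apply/existsP; exists (lift ord0 j); rewrite !inE eqxx orbT /= !ffunE /=.
rewrite /bump /= add1n ltnS leqNgt.
by have -> : 0 < j by apply: leq_ltn_trans ij.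
Qed.

(** * The socle monomials for H_m *)

Section PackingH.
Variable m : nat.
Implicit Types (W : {set 'I_m.+3}) (ws : seq {set 'I_m.+3}).

Let tight_cover W := vertex_cover (H_ m) W && (ord0 \notin W).
Let x_count ws (i : 'I_m.+2) := count (fun W : {set _} => lift ord0 i \in W) ws.

(** At most u_z of the packed covers contain z, so at least s - u_z avoid it;
    all remaining ones may be replaced by {z}. *)
Lemma H_cover_packP s (u : 'I_m.+3 -> nat) :
  cover_pack (H_ m) s u <->
  exists ws, [/\ size ws = s - u ord0, all tight_cover ws &
    forall i, x_count ws i <= u (lift ord0 i)].
Proof.
split=> [[ws [wsz wcv wct]]|[ws [wsz wcv wct]]].
  pose N := [seq W : {set _} <- ws | ord0 \notin W].
  have szN : s - u ord0 <= size N.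
    rewrite size_filter -wsz -(count_predC (fun W : {set _} => ord0 \in W) ws).
    by rewrite leq_subLR leq_add2r.
  exists (take (s - u ord0) N); split; first by rewrite size_takel.
    apply/allP => W /mem_take; rewrite mem_filter => /andP[zW /(allP wcv)].
    by rewrite /tight_cover zW andbT.
  move=> i; apply: leq_trans (wct (lift ord0 i)).
  apply: (@leq_trans (x_count N i)).
    by rewrite -{2}[N](cat_take_drop (s - u ord0)) /x_count count_cat leq_addr.
  by rewrite /x_count count_filter; apply: sub_count => W /andP[].
exists (nseq (minn s (u ord0)) [set ord0]%SET ++ ws); split.
- by rewrite size_cat size_nseq wsz; lia.
- rewrite all_cat all_nseq vertex_cover_HE inE eqxx orbT /=.
  by apply: sub_all wcv => W /andP[].
move=> x; rewrite count_cat count_nseq inE.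
case: (unliftP ord0 x) => [i|] ->; first exact: wct.
rewrite eqxx mul1n; have -> : count (fun W : {set _} => ord0 \in W) ws = 0.
  by apply/eqP; rewrite -leqn0 leqNgt -has_count -all_predC; apply: sub_all wcv => W /andP[].
by rewrite addn0 geq_minr.
Qed.

(** Double counting of the pairs (cover, x_i in it). *)
Lemma tight_cover_count ws : all tight_cover ws ->
  size ws * m.+1 <= \sum_i x_count ws i.
Proof.
elim: ws => [|W ws IHws] //= /andP[/andP[]].
rewrite vertex_cover_HE => /orP[->//|cW] _ /IHws.
rewrite mulSn /x_count big_split /= => /(leq_add _); apply.
rewrite -big_mkcond sum1_card.
have := cardsC [set i : 'I_m.+2 | lift ord0 i \notin W]%SET.
rewrite card_ord; set A := (~: _)%SET => eqA.
have -> : #|[pred i : 'I_m.+2 | lift ord0 i \in W]| = #|A|.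
  by apply: eq_card => i; rewrite !inE negbK.
by lia.
Qed.

(** The degree of u in the x_i is squeezed between t (m + 1) - 1 and
    (m + 2)(t - 1), where t = s - u_z; this forces t >= m + 1. *)
Lemma H_socle_bound s (u : 'X_{1..m.+3}) : ~ cover_pack (H_ m) s u ->
  (forall i, cover_pack (H_ m) s (u + U_(i))%MM) -> m < s.
Proof.
move=> Nu uU; pose t := s - u ord0.
have tight j : exists ws, [/\ size ws = t, all tight_cover ws &
    forall i, x_count ws i <= u (lift ord0 i) + (j == i)].
  have /H_cover_packP [ws []] := uU (lift ord0 j).
  rewrite mnmDE mnm1E eq_sym (negPf (neq_lift _ _)) addn0 => wsz wcv wct.
  exists ws; split=> // i.
  by have := wct i; rewrite mnmDE mnm1E (inj_eq lift_inj).
(* a packing below u x_j is already below u once u_j >= t, having t covers *)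
have u_lt j : u (lift ord0 j) < t.
  rewrite ltnNge; apply/negP => le_tu; apply/Nu/H_cover_packP.
  have [ws [wsz wcv wct]] := tight j; exists ws; split=> // i.
  have := wct i; case: (eqVneq j i) => [<- _|]; last by rewrite addn0.
  by rewrite (leq_trans _ le_tu) // -wsz count_size.
have [ws [wsz wcv wct]] := tight ord0.
have sum_ge : t * m.+1 <= \sum_(i < m.+2) u (lift ord0 i) + 1.
  rewrite -wsz (leq_trans (tight_cover_count wcv)) //.
  rewrite (leq_trans (leq_sum _ (fun i _ => wct i))) // big_split leq_add2l.
  by rewrite (bigD1 ord0) //= big1 // => i /negPf; rewrite eq_sym => ->.
have sum_le : \sum_(i < m.+2) u (lift ord0 i) <= m.+2 * t.-1.
  rewrite -[m.+2 in X in _ <= X]card_ord -sum_nat_const; apply: leq_sum => i _.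
  by have := u_lt i; lia.
have := u_lt ord0; have : t <= s by apply: leq_subr.
by move: sum_ge sum_le; set S := (\sum_(i < _) _) => ????; nia.
Qed.

(** The monomial (x_1 ... x_{m+2})^m. *)
Definition H_socle : 'X_{1..m.+3} :=
  [multinom if i == ord0 then 0 else m | i < m.+3].

Let H_socle0 : H_socle ord0 = 0.
Proof. by rewrite mnmE eqxx. Qed.

Let H_socle_lift i : H_socle (lift ord0 i) = m.
Proof. by rewrite mnmE. Qed.

Lemma H_socle_not_pack : ~ cover_pack (H_ m) m.+1 H_socle.
Proof.
move=> /H_cover_packP [ws []]; rewrite H_socle0 subn0 => wsz wcv wct.
have := tight_cover_count wcv; rewrite wsz; apply/negP; rewrite -ltnNge.
apply: (@leq_ltn_trans (m.+2 * m)); last by nia.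
rewrite -[m.+2 in X in _ <= X]card_ord -sum_nat_const; apply: leq_sum => i _.
by rewrite -(H_socle_lift i).
Qed.

Lemma H_socle_pack i : cover_pack (H_ m) m.+1 (H_socle + U_(i))%MM.
Proof.
apply/H_cover_packP; rewrite mnmDE H_socle0 mnm1E.
case: (unliftP ord0 i) => [j|] ->.
  (* the covers omitting one vertex x_l with l <> j *)
  exists [seq ~: [set ord0; lift ord0 l]%SET | l <- enum (predC1 j)].
  rewrite size_map -cardE cardC1 card_ord subn0; split=> //.
    apply/allP => _ /mapP[l _ ->]; rewrite /tight_cover vertex_cover_HE !inE.
    rewrite eqxx /= andbT; apply/card_le1_eqP => a b; rewrite !inE !negbK !(inj_eq lift_inj).
    by move=> /eqP -> /eqP ->.
  move=> a; rewrite /x_count count_map mnmDE H_socle_lift mnm1E.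
  rewrite (inj_eq lift_inj); case: eqVneq => [->|ja].
    by rewrite addn1 (leq_trans (count_size _ _)) // -cardE cardC1 card_ord.
  rewrite addn0 -ltnS; apply: (@leq_trans (size (enum (predC1 j)))).
    rewrite ltn_neqAle count_size andbT -all_count; apply/allPn; exists a.
      by rewrite mem_enum inE eq_sym.
    by rewrite /= !inE eqxx orbT.
  by rewrite -cardE cardC1 card_ord.
exists (nseq m [set~ ord0]%SET); rewrite size_nseq eqxx subn1; split=> //.
  rewrite all_nseq /tight_cover vertex_cover_HE !inE eqxx /=.
  rewrite (_ : [set _ | _]%SET = finset.set0) ?cards0 ?orbT //.
  by apply/setP => a; rewrite !inE.
by move=> a; rewrite /x_count count_nseq mnmDE H_socle_lift !inE mul1n leq_addr.
Qed.

End PackingH.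

Theorem theorem3p5 (k : fieldType) (m : nat) (hm : (1 <= m)%N) (s0 : nat)
    (hs0 : is_astab (cover_ideal k (H_ m)) s0) :
  (chromatic_number (H_ m) - 1 + m <= s0)%N.
Proof.
have [_ chi2] := chromatic_numberP (H_colourable2 m).
suff : m < s0 by lia.
rewrite ltnNge; apply/negP => le_s0m; have [[_ stable] _] := hs0.
have : Ass (ideal_pow (cover_ideal k (H_ m)) m.+1) (@irrelevant_ideal k _).
  apply/irrelevant_ideal_AssP; exists (H_socle m).
  by split; [apply: H_socle_not_pack | apply: H_socle_pack].
rewrite (stable _ (leqW le_s0m)) => /irrelevant_ideal_AssP [u [Nu uU]].
by have := H_socle_bound Nu uU; rewrite ltnNge le_s0m.
Qed.
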